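(* Let $L$ be a loop with Nuclear-holomorph $H(L)$. Then $L$ is a central-SCL if and only if $H(L)$ is a central-SCL.
   Context: Mappings are written on the right, so $\alpha\beta$ means first $\alpha$, then $\beta$. For a loop $(L,\cdot)$ let $Aum(L,\cdot)$ be its automorphism group. The holomorph $H(L)=(H,\circ)$ is the loop on the set $H$ of pairs $(\alpha,x)$ with $\alpha\in Aum(L,\cdot)$, $x\in L$, with operation $(\alpha,x)\circ(\beta,y)=(\alpha\beta,\ x\beta\cdot y)$. The symbol $x^{-1}$ denotes the two-sided inverse of $x$ (assumed to exist in $L$). The nucleus $N(L)$ is the set of $a\in L$ with $a\cdot xy=ax\cdot y$, $x\cdot ay=xa\cdot y$, $x\cdot ya=xy\cdot a$ for all $x,y\in L$. $H(L)$ is called a Nuclear-holomorph of $L$ if $x^{-1}\cdot x\alpha\in N(L)$ or $x\alpha\cdot x^{-1}\in N(L)$ for all $x\in L$ and $\alpha\in Aum(L,\cdot)$. A central loop (C-loop) is a loop satisfying the identity $(yx\cdot x)z=y(x\cdot xz)$. A loop is a Smarandache central loop (SCL) if it has at least one non-trivial subloop that is a central loop. A central-SCL is a loop that is both a central loop and a SCL. *)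

(* Defs.v *)
From HB Require Import structures.
From mathcomp Require Import all_boot.
From mathcomp Require Import boolp classical_sets.

Set Implicit Arguments.
Unset Strict Implicit.
Unset Printing Implicit Defensive.

Local Open Scope classical_set_scope.
Local Open Scope group_scope.

HB.mixin Record UMagma_isLoop L of UMagma L := {
  loop_ldiv : forall a b : L, exists! x, a * x = b;
  loop_rdiv : forall a b : L, exists! x, x * a = b
}.

#[short(type="loopType")]
HB.structure Definition Loop := {L of UMagma_isLoop L & UMagma L}.

Section LoopTheory.
Variable L : loopType.
Implicit Types a x y : L.

Lemma loop_mulIl a : injective (mul a).
Proof.
by move=> x y e; have [z [_ u]] := loop_ldiv a (a * y); rewrite -(u x e) (u y).
Qed.

Lemma loop_mulIr a : injective (mul^~ a).
Proof.
by move=> x y e; have [z [_ u]] := loop_rdiv a (y * a); rewrite -(u x e) (u y).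
Qed.

(* Morphisms of loops automatically preserve 1, so {multiplicative L -> L} *)
(* suffices for automorphisms.                                             *)
Lemma loop_morph1 (f : {multiplicative L -> L}) : f 1 = 1.
Proof. by apply: (@loop_mulIl (f 1)); rewrite -gmulfM !mulg1. Qed.

End LoopTheory.

Definition has_two_sided_inverses (L : loopType) :=
  forall x : L, exists y : L, x * y = 1 /\ y * x = 1.

(* The two-sided inverse of x; the default value 1 is only taken when x has *)
(* no two-sided inverse.                                                    *)
Definition loop_inv (L : loopType) (x : L) : L :=
  xget 1 [set y : L | x * y = 1 /\ y * x = 1].

Definition nucleus (L : loopType) : set L :=
  [set a : L | forall x y : L,
     [/\ a * (x * y) = (a * x) * y,
         x * (a * y) = (x * a) * y
       & x * (y * a) = (x * y) * a]].

Arguments nucleus L : clear implicits.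

Definition central_loop (L : loopType) :=
  forall x y z : L, ((y * x) * x) * z = y * (x * (x * z)).

(* Subloops: subsets that are loops under the induced operation. *)
Record subloop (L : loopType) := Subloop {
  subloop_set :> set L;
  subloop1 : subloop_set 1;
  subloopM : forall a b : L, subloop_set a -> subloop_set b ->
    subloop_set (a * b);
  subloop_ldiv : forall a x : L, subloop_set a -> subloop_set (a * x) ->
    subloop_set x;
  subloop_rdiv : forall a x : L, subloop_set a -> subloop_set (x * a) ->
    subloop_set x
}.

Record subloop_sort (L : loopType) (S : subloop L) := SubloopElt {
  subloop_val : L;
  subloop_valP : subloop_val \in subloop_set S
}.

Section SubloopInstance.
Variables (L : loopType) (S : subloop L).

HB.instance Definition _ := [isSub for @subloop_val L S].
HB.instance Definition _ := [Choice of subloop_sort S by <:].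

Fact subloop_umagma_closed :
  umagma_closed (fun x : L => x \in subloop_set S).
Proof.
split=> [|a b]; first by rewrite unfold_in; apply/mem_set/subloop1.
by rewrite !unfold_in => /set_mem Sa /set_mem Sb; apply/mem_set/subloopM.
Qed.

HB.instance Definition _ :=
  SubChoice_isSubUMagma.Build L (fun x : L => x \in subloop_set S)
    (subloop_sort S) subloop_umagma_closed.

Fact subloop_ldivP (a b : subloop_sort S) : exists! x, a * x = b.
Proof.
have [x [e u]] := loop_ldiv (val a) (val b).
have Sx : x \in subloop_set S.
  apply/mem_set/(@subloop_ldiv _ _ (val a)); first exact/set_mem/(valP a).
  by rewrite e; apply/set_mem/(valP b).
exists (Sub x Sx); split; first by apply/val_inj; rewrite valM SubK.
by move=> y ey; apply/val_inj; rewrite SubK; apply: u; rewrite -valM ey.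
Qed.

Fact subloop_rdivP (a b : subloop_sort S) : exists! x, x * a = b.
Proof.
have [x [e u]] := loop_rdiv (val a) (val b).
have Sx : x \in subloop_set S.
  apply/mem_set/(@subloop_rdiv _ _ (val a)); first exact/set_mem/(valP a).
  by rewrite e; apply/set_mem/(valP b).
exists (Sub x Sx); split; first by apply/val_inj; rewrite valM SubK.
by move=> y ey; apply/val_inj; rewrite SubK; apply: u; rewrite -valM ey.
Qed.

HB.instance Definition _ :=
  UMagma_isLoop.Build (subloop_sort S) subloop_ldivP subloop_rdivP.

End SubloopInstance.

(* "Non-trivial" means different from {1}; L itself is allowed. *)
Definition smarandache_central_loop (L : loopType) :=
  exists S : subloop L,
    (S : set L) <> [set 1] /\ central_loop (subloop_sort S).

Definition central_SCL (L : loopType) :=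
  central_loop L /\ smarandache_central_loop L.

Record Aum (L : loopType) := Automorphism {
  aum_fun :> {multiplicative L -> L};
  aum_bij : bijective aum_fun
}.

Section AumGroup.
Variable L : loopType.
Implicit Types f g h : Aum L.

Lemma aumP f g : (f =1 g) -> f = g.
Proof.
case: f g => [[f [[fM]]] fb] [[g [[gM]]] gb] /= /funext e.
move: fM fb; rewrite e => fM fb.
by rewrite (Prop_irrelevance fM gM) (Prop_irrelevance fb gb).
Qed.

HB.instance Definition _ := gen_eqMixin (Aum L).
HB.instance Definition _ := gen_choiceMixin (Aum L).

Fact aum_inv_subproof f : exists g : Aum L, cancel f g /\ cancel g f.
Proof.
have [g fK gK] := aum_bij f.
pose gM := isMultiplicative.Build L L g (can2_gmulfM fK gK).
pose g' : {multiplicative L -> L} := HB.pack g gM.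
by exists (@Automorphism L g' (Bijective gK fK)).
Qed.

Definition aum_one : Aum L :=
  @Automorphism L (idfun : {multiplicative L -> L})
    (Bijective (frefl idfun) (frefl idfun)).

(* Mappings act on the right: f * g is f followed by g. *)
Definition aum_mul f g : Aum L :=
  @Automorphism L (g \o f : {multiplicative L -> L})
    (bij_comp (aum_bij g) (aum_bij f)).

Definition aum_inv f : Aum L := projT1 (cid (aum_inv_subproof f)).

Fact aum_mulA : associative aum_mul.
Proof. by move=> f g h; apply: aumP. Qed.

Fact aum_mul1 : left_id aum_one aum_mul.
Proof. by move=> f; apply: aumP. Qed.

Fact aum_mulr1 : right_id aum_one aum_mul.
Proof. by move=> f; apply: aumP. Qed.

Fact aum_mulV : left_inverse aum_one aum_inv aum_mul.
Proof.
move=> f; apply: aumP => x.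
by have [_ K] := projT2 (cid (aum_inv_subproof f)); apply: K.
Qed.

Fact aum_mulrV : right_inverse aum_one aum_inv aum_mul.
Proof.
move=> f; apply: aumP => x.
by have [K _] := projT2 (cid (aum_inv_subproof f)); apply: K.
Qed.

HB.instance Definition _ :=
  isGroup.Build (Aum L) aum_mulA aum_mul1 aum_mulr1 aum_mulV aum_mulrV.

Lemma aumM f g x : (f * g) x = g (f x).
Proof. by []. Qed.

Lemma aum1 x : (1 : Aum L) x = x.
Proof. by []. Qed.

Lemma aumK f : cancel f f^-1.
Proof. by move=> x; rewrite -aumM mulgV. Qed.

Lemma aumVK f : cancel f^-1 f.
Proof. by move=> x; rewrite -aumM mulVg. Qed.

End AumGroup.

(* A record rather than the product type, which already carries the *)
(* componentwise multiplication.                                    *)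
Record holomorph (L : loopType) := Holomorph {
  hol_aum : Aum L;
  hol_elt : L
}.

Section HolomorphLoop.
Variable L : loopType.
Implicit Types p q : holomorph L.

HB.instance Definition _ := gen_eqMixin (holomorph L).
HB.instance Definition _ := gen_choiceMixin (holomorph L).

Definition hol_one : holomorph L := Holomorph 1 1.

Definition hol_mul p q : holomorph L :=
  Holomorph (hol_aum p * hol_aum q) (hol_aum q (hol_elt p) * hol_elt q).

HB.instance Definition _ := hasMul.Build (holomorph L) hol_mul.

Fact hol_mul1 : left_id hol_one (@mul (holomorph L)).
Proof.
by case=> f x; rewrite /mul /= /hol_mul /= loop_morph1 !mul1g.
Qed.

Fact hol_mulr1 : right_id hol_one (@mul (holomorph L)).
Proof. by case=> f x; rewrite /mul /= /hol_mul /= !mulg1. Qed.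

HB.instance Definition _ :=
  Magma_isUMagma.Build (holomorph L) hol_mul1 hol_mulr1.

Lemma hol_mulE (f g : Aum L) (x y : L) :
  Holomorph f x * Holomorph g y = Holomorph (f * g) (g x * y).
Proof. by []. Qed.

Fact hol_ldivP p q : exists! r, p * r = q.
Proof.
case: p q => [f x] [g y].
have [z [e u]] := loop_ldiv ((f^-1 * g) x) y.
exists (Holomorph (f^-1 * g) z); split; first by rewrite hol_mulE mulVKg e.
case=> h w; rewrite hol_mulE => -[fh ew].
have eh : f^-1 * g = h by rewrite -fh mulKg.
by rewrite eh in u *; rewrite (u w ew).
Qed.

Fact hol_rdivP p q : exists! r, r * p = q.
Proof.
case: p q => [f x] [g y].
have [z [e u]] := loop_rdiv x y.
exists (Holomorph (g * f^-1) (f^-1 z)); split.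
  by rewrite hol_mulE mulgVK aumVK e.
case=> h w; rewrite hol_mulE => -[hf ew].
by rewrite -hf mulgK (u _ ew) aumK.
Qed.

HB.instance Definition _ :=
  UMagma_isLoop.Build (holomorph L) hol_ldivP hol_rdivP.

End HolomorphLoop.

Definition nuclear_holomorph (L : loopType) :=
  forall (x : L) (f : Aum L),
    nucleus L (loop_inv x * f x) \/ nucleus L (f x * loop_inv x).

(* Main.v *)
Require Import Defs.
From mathcomp Require Import all_boot.
From mathcomp Require Import boolp classical_sets.

Set Implicit Arguments.
Unset Strict Implicit.
Unset Printing Implicit Defensive.

Local Open Scope group_scope.

(** Every subloop of a central loop is central, and the whole loop counts as a
    subloop of itself, so a central loop is Smarandache exactly when it is not
    reduced to 1.  A trivial loop has only the identity automorphism, hence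
    triviality passes between [L] and its holomorph, and the theorem reduces to
    the central identity.

    Multiplying out in the holomorph and substituting through automorphisms
    turns its central identity into the twisted identity
    [((y * f x) * x) * z = y * (f x * (x * z))] in [L], for all automorphisms
    [f] ([central_holomorphP]); [f = 1] gives back the central identity of [L].
    Conversely, a central loop has the inverse property, so the nuclear
    hypothesis says that [w = f x] differs from [x] by a nuclear factor: either
    [w = n * x], or [w = x * n], that is [x = w * m] with [m] the inverse of
    [n].  In both cases the nuclear factor stands outside the pair of equal
    factors and can be moved away, so that the twisted identity becomes the
    central identity at [x], respectively at [w]
    ([central_nuclear_left], [central_nuclear_right]). *)

Lemma loop_invP (L : loopType) (x : L) : has_two_sided_inverses L ->
  x * loop_inv x = 1 /\ loop_inv x * x = 1.
Proof. by move/(_ x)/(xgetPex 1). Qed.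

(** In the central identity [((a * b) * b) * u = a * (b * (b * u))] the product
    [a * b] cancels on the left, and [b * u] ranges over the whole loop. *)
Lemma central_mulKl (L : loopType) (a b : L) : central_loop L ->
  a * b = 1 -> forall z, a * (b * z) = z.
Proof.
move=> cL ab z; have [u [<- _]] := loop_ldiv b z.
by rewrite -cL ab mul1g.
Qed.

Lemma central_mulKr (L : loopType) (a b : L) : central_loop L ->
  b * a = 1 -> forall z, (z * b) * a = z.
Proof.
move=> cL ba z; have [u [<- _]] := loop_rdiv b z.
by rewrite cL ba mulg1.
Qed.

(** Each associativity with [m] is checked after cancelling or inserting the
    nuclear factor [n]. *)
Lemma nucleus_inv (L : loopType) (n m : L) : nucleus L n ->
  n * m = 1 -> m * n = 1 -> nucleus L m.
Proof.
move=> nN nm mn.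
have nA x y : n * (x * y) = (n * x) * y by case: (nN x y).
have An x y : x * (n * y) = (x * n) * y by case: (nN x y).
have AN x y : x * (y * n) = (x * y) * n by case: (nN x y).
have nK x : n * (m * x) = x by rewrite nA nm mul1g.
have mK x : (x * m) * n = x by rewrite -AN mn mulg1.
split.
- by apply: (@loop_mulIl _ n); rewrite nK nA nK.
- by rewrite -[in LHS](mK x) -An nK.
- by apply: (@loop_mulIr _ n); rewrite mK -AN mK.
Qed.

Lemma central_nuclear_left (L : loopType) (n : L) : central_loop L ->
  nucleus L n ->
  forall x y z : L, ((y * (n * x)) * x) * z = y * ((n * x) * (x * z)).
Proof.
move=> cL nN x y z.
have nA a b : n * (a * b) = (n * a) * b by case: (nN a b).
have An a b : a * (n * b) = (a * n) * b by case: (nN a b).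
by rewrite An cL -An -nA.
Qed.

Lemma central_nuclear_right (L : loopType) (m : L) : central_loop L ->
  nucleus L m ->
  forall w y z : L, ((y * w) * (w * m)) * z = y * (w * ((w * m) * z)).
Proof.
move=> cL mN w y z.
have Am a b : a * (m * b) = (a * m) * b by case: (mN a b).
have AM a b : a * (b * m) = (a * b) * m by case: (mN a b).
by rewrite AM -!Am cL.
Qed.

(** The product of the holomorph applies the third automorphism to both
    occurrences of the squared element, so the pair [(f x, x)] appears as
    [(g (f x), g x)]; conjugating [f] by [g] brings it back to the stated
    form. *)
Lemma central_holomorphP (L : loopType) : central_loop (holomorph L) <->
  forall (f : Aum L) (x y z : L),
    ((y * f x) * x) * z = y * (f x * (x * z)).
Proof.
split=> [cH f x y z | cf [f x] [h y] [g z]].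
  have := cH (Holomorph f x) (Holomorph 1 (f^-1 (f^-1 y))) (Holomorph 1 z).
  rewrite !hol_mulE => /(congr1 (@hol_elt L)); rewrite /hol_elt.
  by rewrite !aumM !aum1 !gmulfM !aumVK.
rewrite !hol_mulE; congr Holomorph; first by rewrite !mulgA.
rewrite !aumM !gmulfM.
by have := cf (g^-1 * (f * g)) (g x) (g (f (f y))) z; rewrite !aumM aumK.
Qed.

Lemma central_holomorph (L : loopType) : has_two_sided_inverses L ->
  nuclear_holomorph L -> central_loop L -> central_loop (holomorph L).
Proof.
move=> invL nucL cL; apply/central_holomorphP => f x y z.
have [xV Vx] := loop_invP x invL.
case: (nucL x f) => [nN | nN].
- set n := loop_inv x * f x in nN.
  have fxE : f x = x * n by rewrite /n central_mulKl.
  have [nV Vn] := loop_invP n invL.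
  have xE : x = f x * loop_inv n by rewrite fxE central_mulKr.
  have := central_nuclear_right cL (nucleus_inv nN nV Vn) (f x) y z.
  by rewrite -xE.
- set n := f x * loop_inv x in nN.
  have fxE : f x = n * x by rewrite /n central_mulKr.
  by rewrite fxE; apply: central_nuclear_left.
Qed.

Lemma central_of_holomorph (L : loopType) :
  central_loop (holomorph L) -> central_loop L.
Proof. by move/central_holomorphP => cf x y z; apply: (cf 1). Qed.

Definition full_subloop (L : loopType) : subloop L :=
  @Subloop L setT I (fun _ _ _ _ => I) (fun _ _ _ _ => I) (fun _ _ _ _ => I).

Lemma central_subloop (L : loopType) (S : subloop L) :
  central_loop L -> central_loop (subloop_sort S).
Proof. by move=> cL x y z; apply: val_inj; rewrite !valM cL. Qed.

Lemma central_SCLP (L : loopType) :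
  central_SCL L <-> central_loop L /\ exists x : L, x <> 1.
Proof.
split=> [[cL [S [S1 _]]] | [cL [x x1]]]; split=> //.
  apply: contrapT => /forallNP triv; apply: S1; apply/seteqP; split=> x /=.
    by move=> _; apply: contrapT (triv x).
  by move->; apply: subloop1.
exists (full_subloop L); split; last exact: central_subloop.
by move=> /seteqP[/(_ x I)].
Qed.

Lemma holomorph_nontrivial (L : loopType) :
  (exists x : L, x <> 1) <-> exists p : holomorph L, p <> 1.
Proof.
split=> [[x x1] | [[f x] p1]]; first by exists (Holomorph 1 x) => -[].
apply: contrapT => /forallNP triv; apply: p1.
have L1 y : y = 1 :> L by apply: contrapT (triv y).
(* In a trivial loop any two automorphisms agree. *)
have -> : f = 1 by apply: aumP => y; rewrite (L1 (f y)) (L1 (_ y)).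
by rewrite (L1 x).
Qed.

Theorem theorem3p13 (L : loopType) (L_inv : has_two_sided_inverses L)
  (H_nuclear : nuclear_holomorph L) :
  central_SCL L <-> central_SCL (holomorph L).
Proof.
rewrite !central_SCLP -holomorph_nontrivial.
split=> -[c nt]; split=> //.
- exact: central_holomorph.
- exact: central_of_holomorph.
Qed.
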